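(* Let $(X,r)$ be an indecomposable solution with $X$ finite and $|X|$ square-free. Then the Dehornoy's class of $(X,r)$ is equal to $|X|$.
   Context: A solution is a pair $(X,r)$ with $X$ a non-empty set and $r:X\times X\to X\times X$, $r(x,y)=(\sigma_x(y),\tau_y(x))$, such that $(r\times \mathrm{id})(\mathrm{id}\times r)(r\times \mathrm{id})=(\mathrm{id}\times r)(r\times \mathrm{id})(\mathrm{id}\times r)$ on $X^3$, $r^2=\mathrm{id}$ (involutive), and all maps $\sigma_x,\tau_y:X\to X$ are bijections (non-degenerate). The permutation group $\mathcal{G}(X,r)$ is the subgroup of $\mathrm{Sym}(X)$ generated by all $\sigma_x$. $(X,r)$ is indecomposable if $\mathcal{G}(X,r)$ acts transitively on $X$. Dehornoy's class: set $x\cdot y=\sigma_x^{-1}(y)$ and define $\Omega_n:X^n\to X$ by $\Omega_1(x_1)=x_1$ and $\Omega_n(x_1,\dots,x_n)=\Omega_{n-1}(x_1,\dots,x_{n-1})\cdot\Omega_{n-1}(x_1,\dots,x_{n-2},x_n)$ for $n>1$. The Dehornoy's class of $(X,r)$ is the minimal positive integer $d$ such that $\Omega_{d+1}(x,x,\dots,x,y)=y$ for all $x,y\in X$. *)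

(* Defs.v *)
From mathcomp Require Import all_boot all_fingroup.
Set Implicit Arguments.
Unset Strict Implicit.
Unset Printing Implicit Defensive.

Section YangBaxter.
Variables (X : Type) (r : X * X -> X * X).

Definition r12 (t : X * X * X) : X * X * X :=
  let: (x, y, z) := t in (r (x, y), z).

Definition r23 (t : X * X * X) : X * X * X :=
  let: (x, y, z) := t in (x, (r (y, z)).1, (r (y, z)).2).

(* r (x, y) = (sigma_of x y, tau_of y x) *)
Definition sigma_of (x y : X) : X := (r (x, y)).1.
Definition tau_of (y x : X) : X := (r (x, y)).2.

End YangBaxter.

Record solution (X : Type) := Solution {
  sol_r : X * X -> X * X;
  sol_nonempty : inhabited X;
  sol_braid : forall t, r12 sol_r (r23 sol_r (r12 sol_r t)) =
                        r23 sol_r (r12 sol_r (r23 sol_r t));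
  sol_invol : forall u, sol_r (sol_r u) = u;
  sol_sigma_bij : forall x, bijective (sigma_of sol_r x);
  sol_tau_bij : forall y, bijective (tau_of sol_r y)
}.

Section FiniteSolution.
Variables (X : finType) (S : solution X).

Definition sigma (x : X) : {perm X} := perm (bij_inj (sol_sigma_bij S x)).

Definition permutation_group : {group {perm X}} :=
  <<[set sigma x | x : X]>>%G.

Definition indecomposable : bool :=
  [transitive permutation_group, on [set: X] | 'P].

Definition dot (x y : X) : X := (sigma x)^-1%g y.

(* Omega n is the (n+1)-ary operation usually written Omega_{n+1}, on families
   indexed by 0, ..., n. Composing with lift ord_max deletes the last entry of
   a family; composing with lift (inord n) deletes the entry before it. *)
Fixpoint Omega (n : nat) : ('I_n.+1 -> X) -> X :=
  match n with
  | 0 => fun x => x ord0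
  | m.+1 => fun x : 'I_m.+2 -> X =>
      dot (Omega (fun i : 'I_m.+1 => x (lift ord_max i)))
          (Omega (fun i : 'I_m.+1 => x (lift (inord m) i)))
  end.

(* Omega_{d+1}(x, ..., x, y) = y for all x and y *)
Definition Dehornoy_condition (d : nat) : Prop :=
  forall x y : X, Omega (fun i : 'I_d.+1 => if i == ord_max then y else x) = y.

Definition is_Dehornoy_class (d : nat) : Prop :=
  [/\ 0 < d, Dehornoy_condition d &
      forall e, 0 < e -> Dehornoy_condition e -> d <= e].

End FiniteSolution.

Definition square_free (n : nat) : Prop := forall m, m ^ 2 %| n -> m = 1.

(* Main.v *)
Require Import Defs.
From HB Require Import structures.
From mathcomp Require Import all_boot all_fingroup all_solvable.
From mathcomp Require Import integral_char.
Set Implicit Arguments.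
Unset Strict Implicit.
Unset Printing Implicit Defensive.
Import GroupScope.

(** Write [n] for the cardinality of [X] and [d x] for the inverse of
    [sigma x].  The cycle set identity
    [d x * d (d x y) = d y * d (d y x)] ([left_div_cycle]) says that a finite
    multiset of points determines a permutation [mset_perm]: apply [d] at one
    of its points, move the remaining points along, and repeat, in any order.
    Union of multisets therefore induces on the permutation group [G] of the
    solution a commutative group law [⊞], with [x ⊞ y = x * (y ◃ x)] for an
    action [◃] of [G] on itself; such a structure is a brace.  The operation
    [Omega] at [(x, ..., x, y)], with [e] entries [x], is the value at [y] of
    the [e]-fold [⊞]-multiple of [d x], so the Dehornoy class is the exponent
    of the abelian group [(G, ⊞)] ([Dehornoy_multiple]).

    That exponent is a multiple of [n]: transitivity makes [n] divide the order
    of [G], so by Cauchy's theorem every prime divisor of [n] is the order of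
    some element of [(G, ⊞)], and [n] is square-free.

    Conversely [n] annihilates [(G, ⊞)] ([square_free_exponent]).  Let [A_pi]
    be the additive [pi]-part of [G]; it is a multiplicative subgroup too, and
    a Hall subgroup.  So [G] has a Hall [p']-subgroup for every prime [p] and
    is solvable by the converse of Hall's theorem; thus [N], the largest normal
    [r]-subgroup of [G], is nontrivial for some prime [r].  Put [A = A_r] and
    [B = A_r'].  The heart of the proof ([central_part]) is that [A] acts
    trivially on the whole of [G].
    - Comparing additive components in [n * g = g * n ^ g] shows that [N] acts
      trivially on [B].
    - As [r ^ 2] does not divide [n], some point [x] has an [A]-orbit of at
      most [r] points.  It coincides with the [N]-orbit of [x], so [A] fixes
      the component [b] of [d x] in [B], whose [B]-orbit spans [B].
    - Square-free orbits give multipermutation braces: every proper ideal [T]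
      of [B] is properly contained in the ideal of the elements of [B] that act
      trivially modulo [T].  Going down this series from [B] to [1], one finds
      that [A] acts trivially on [B] ([act_trivial_cofactor]).
    - Then [A] is normal with orbits of size [r], hence elementary abelian.  If
      [A] did not act trivially on itself, then a point and the component of
      its [d] in [A] would have the same stabiliser in [A]; a nontrivial
      fixed point of the [r]-group [A] on itself would then fix every point
      ([act_trivial_part]).
    The multipermutation property used here is obtained from the same
    statement by induction on the order of the brace ([square_free_socle]).
    Now [A] is annihilated by [r], while [B] acts faithfully and transitively
    on the [n / r] orbits of [A]; induction on the order of [G] finishes the
    proof. *)

(** * The converse of Hall's theorem *)

Section HallConverse.
Variable gT : finGroupType.
Implicit Types (G H K M N : {group gT}) (p q : nat).

(** Hall subgroups for the complements of two primes have coprime indices, so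
    they factorise the group, and the index of the intersection in one of them
    is the index of the other. *)
Lemma Hall_setI G H K p q : p != q ->
  p^'.-Hall(G) H -> q^'.-Hall(G) K -> H * K = G /\ q^'.-Hall(H) (H :&: K).
Proof.
move=> neq_pq hallH hallK.
have [sHG _ iH] := and3P hallH; have [sKG q'K iK] := and3P hallK.
have co : coprime #|G : H| #|G : K|.
  apply: p'nat_coprime iH _; rewrite pnatNK in iK *.
  by apply: sub_in_pnat iK => r _ /eqP ->; rewrite !inE eq_sym.
have eG : H * K = G by apply: coprime_index_mulG.
split=> //; rewrite /pHall subsetIl (pgroupS (subsetIr _ _) q'K) /=.
suff -> : #|H : H :&: K| = #|G : K| by [].
apply/eqP; rewrite -(eqn_pmul2l (cardG_gt0 (H :&: K))) Lagrange ?subsetIl //.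
rewrite -(eqn_pmul2l (cardG_gt0 K)) mulnCA Lagrange //.
by rewrite mulnC mul_cardG eG mulnC.
Qed.
End HallConverse.

(** Induction on the order; Burnside's theorem covers two primes.  With three
    primes, the Hall subgroups [H], [K], [L] are solvable by induction.  A
    minimal normal subgroup [M] of [H] is a [t]-group for some prime [t], hence
    lies in [K] or in [L], whichever belongs to a prime other than [t].  Call
    it [J]: as the group is [H * J] and [H] normalises [M], every conjugate of
    [M] is in [J], so the normal closure of [M] is solvable. *)
Lemma solvable_Hall_subgroups (gT : finGroupType) (G : {group gT}) :
  (forall p, p \in \pi(G) -> exists H : {group gT}, p^'.-Hall(G) H) -> solvable G.
Proof.
have [n] := ubnP #|G|; elim: n => // n IHn in gT G * => /ltnSE leGn hallG.
have [|] := leqP (size (primes #|G|)) 2; first exact: Burnside_p_a_q_b.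
case Epr: (primes #|G|) => [|p [|q [|s ps]]] //= _.
have uniq_pr : uniq [:: p, q, s & ps] by rewrite -Epr primes_uniq.
have mem_pi r : (r \in \pi(G)) = (r \in [:: p, q, s & ps]) by rewrite -Epr.
have [piP piQ piS] : [/\ p \in \pi(G), q \in \pi(G) & s \in \pi(G)].
  by rewrite !mem_pi !inE !eqxx !orbT.
have [neq_pq neq_ps neq_qs] : [/\ p != q, p != s & q != s].
  by move: uniq_pr; rewrite /= !inE !negb_or => /and4P[/and3P[-> -> _] /andP[-> _]].
have ltHall r (H : {group gT}) : r \in \pi(G) -> r^'.-Hall(G) H -> #|H| < #|G|.
  rewrite mem_primes => /and3P[pr_r _ r_dv] hallH.
  rewrite ltn_neqAle subset_leq_card ?(pHall_sub hallH) // andbT.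
  apply/eqP=> eHG; have := pHall_pgroup hallH.
  by rewrite /pgroup p'natE // eHG r_dv.
have solHall r (H : {group gT}) : r \in \pi(G) -> r^'.-Hall(G) H -> solvable H.
  move=> piGr hallH; apply: IHn.
    by apply: leq_trans (ltHall r H _ _) leGn.
  move=> t piHt.
  have [|K hallK] := hallG t.
    by apply: (pi_of_dvd _ _ piHt); rewrite ?cardG_gt0 // cardSg ?(pHall_sub hallH).
  exists (H :&: K)%G; apply: (Hall_setI _ hallH hallK).2.
  apply: contraTneq piHt => <-.
  by rewrite -p'natEpi ?cardG_gt0 //; exact: pHall_pgroup hallH.
have [H hallH] := hallG p piP; have [K hallK] := hallG q piQ.
have [L hallL] := hallG s piS.
have ntH : H :!=: 1.
  apply/eqP=> H1; have := card_Hall hallH; rewrite H1 cards1 => /esym/eqP.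
  rewrite partn_eq1 ?cardG_gt0 // pnatNK => pG.
  move: piQ; rewrite mem_primes => /and3P[pr_q _ q_dv].
  have /eqP eqp := pgroupP pG q pr_q q_dv.
  by rewrite eqp eqxx in neq_pq.
have [M minM sMH] := minnormal_exists ntH (normG H).
have [nMH ntM abM] := minnormal_solvable minM sMH (solHall p H piP hallH).
have nsMH : M <| H by apply/andP.
(* A normal subgroup of order prime to r lies in every Hall r'-subgroup, here
   in that of H *)
have sub_Hall r (J : {group gT}) : p != r -> r^'.-Hall(G) J -> r^'.-group M -> M \subset J.
  move=> neq_pr hallJ r'M; have [_ hallHJ] := Hall_setI neq_pr hallH hallJ.
  have := normal_sub_max_pgroup (Hall_max hallHJ) r'M nsMH.
  by rewrite subsetI => /andP[].
have [r [J [neq_pr piR hallJ sMJ]]] : exists r, exists J : {group gT},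
    [/\ p != r, r \in \pi(G), r^'.-Hall(G) J & M \subset J].
  have [t pr_t /and3P[tM _ _]] := is_abelemP abM.
  have t'M r : t != r -> r^'.-group M.
    by move=> neq_tr; apply: sub_in_pnat tM => u _ /eqP ->; rewrite !inE.
  have [eq_tq|neq_tq] := eqVneq t q.
    by exists s, L; split=> //; apply: (sub_Hall s) => //; apply: t'M; rewrite eq_tq.
  by exists q, K; split=> //; apply: (sub_Hall q) => //; apply: t'M.
have [eG _] := Hall_setI neq_pr hallH hallJ.
pose N := <<class_support M G>>%G.
have sNJ : N \subset J.
  rewrite gen_subG; apply/subsetP=> _ /imset2P[m g Mm Gg ->].
  move: Gg; rewrite -eG => /mulsgP[h j Hh Jj ->].
  rewrite conjgM memJ_norm ?(subsetP (normG J)) //.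
  by rewrite (subsetP sMJ) // memJ_norm ?(subsetP nMH).
have nsNG : N <| G.
  rewrite /normal norms_gen ?class_support_norm // andbT.
  by rewrite (subset_trans sNJ) ?(pHall_sub hallJ).
have ntN : N :!=: 1.
  apply: contraNneq ntM => N1; rewrite -subG1 -N1.
  exact: subset_trans (sub_class_support G M) (subset_gen _).
rewrite (series_sol nsNG) (solvableS sNJ (solHall r J piR hallJ)) /=.
apply: IHn; first by apply: leq_trans leGn; rewrite ltn_quotient ?(normal_sub nsNG).
move=> t piGNt; have [|U hallU] := hallG t.
  by apply: (pi_of_dvd _ _ piGNt); rewrite ?cardG_gt0 // dvdn_quotient.
exists (U / N)%G; apply: quotient_pHall (hallU).
by rewrite (subset_trans (pHall_sub hallU)) ?normal_norm.
Qed.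

(** * Braces *)

(** Right-handed convention, to agree with the composition order of
    permutations and with right actions: the group law is the circle operation
    of the brace, and the two last axioms say that [x * (y ◃ x)] is commutative
    in [x] and [y] and that [◃ g] is additive for it.  Associativity of the
    addition follows from these. *)
Record brace := Brace {
  brace_group :> finGroupType;
  bact : brace_group -> brace_group -> brace_group;
  bact1 : forall x, bact x 1 = x;
  bactM : forall x g h, bact x (g * h) = bact (bact x g) h;
  bmulC : forall x y, x * bact y x = y * bact x y;
  bactMr : forall x y g,
    bact (x * bact y x) g = bact x g * bact (bact y g) (bact x g) }.

Notation "x ◃ g" := (bact x g) (at level 38, left associativity).
Definition badd (G : brace) (x y : G) : G := x * (y ◃ x).
Notation "x ⊞ y" := (badd x y) (at level 48, left associativity).
Definition bopp (G : brace) (x : G) : G := x^-1 ◃ x^-1.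

Section BraceAddition.
Variable G : brace.
Implicit Types x y z g h : G.

Lemma bactK g : cancel (fun x : G => x ◃ g) (fun x : G => x ◃ g^-1).
Proof. by move=> x; rewrite -bactM mulgV bact1. Qed.
Lemma bactKV g : cancel (fun x : G => x ◃ g^-1) (fun x : G => x ◃ g).
Proof. by move=> x; rewrite -bactM mulVg bact1. Qed.
Lemma bact_inj g : injective (fun x : G => x ◃ g).
Proof. exact: can_inj (bactK g). Qed.

Lemma baddC x y : x ⊞ y = y ⊞ x.
Proof. exact: bmulC. Qed.

Lemma bactD x y g : (x ⊞ y) ◃ g = (x ◃ g) ⊞ (y ◃ g).
Proof. exact: bactMr. Qed.

Lemma badd0 x : 1 ⊞ x = x.
Proof. by rewrite /badd mul1g bact1. Qed.

Lemma baddr0 x : x ⊞ 1 = x.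
Proof. by rewrite baddC badd0. Qed.

Lemma bact1l g : (1 : G) ◃ g = 1.
Proof. by apply: (mulgI g); rewrite -/(badd g 1) baddr0 mulg1. Qed.

Lemma mulg_badd x y : x * y = x ⊞ (y ◃ x^-1).
Proof. by rewrite /badd bactKV. Qed.

Lemma baddA x y z : x ⊞ (y ⊞ z) = x ⊞ y ⊞ z.
Proof. by rewrite {1}/badd bactD /badd !mulgA !bactM. Qed.

Lemma baddNr x : bopp x ⊞ x = 1.
Proof. by rewrite baddC /badd bactKV mulgV. Qed.
End BraceAddition.

(** A second name for the carrier, on which the group law is [⊞]: this gives
    access to the theory of finite abelian groups. *)
Definition additive (G : brace) : Type := G.

Section AdditiveGroup.
Variable G : brace.
HB.instance Definition _ := Finite.copy (additive G) G.
Fact additive_mulA : associative (fun x y : additive G => badd x y : additive G).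
Proof. by move=> x y z; rewrite /= baddA. Qed.
Fact additive_mul1 : left_id (1%g : G) (fun x y : additive G => badd x y : additive G).
Proof. exact: badd0. Qed.
Fact additive_mulV :
  left_inverse (1%g : G) (@bopp G) (fun x y : additive G => badd x y : additive G).
Proof. exact: baddNr. Qed.
HB.instance Definition _ := Finite_isGroup.Build (additive G)
  additive_mulA additive_mul1 additive_mulV.
End AdditiveGroup.

Section Parts.
Variable G : brace.
Implicit Types x y z g h : G.
Implicit Type pi : nat_pred.

Lemma additive_abelian : abelian [set: additive G].
Proof. by apply/centsP=> x _ y _; apply: baddC. Qed.

Lemma act_morphic g :
  {in [set: additive G] &,
    {morph (fun x : additive G => (x : G) ◃ g : additive G) : x y / (x * y)%g}}.
Proof. by move=> x y _ _; apply: bactD. Qed.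
Definition act_morph g := Morphism (act_morphic g).

Definition part pi x : G := (x : additive G).`_pi.

Lemma partD pi x y : part pi (x ⊞ y) = part pi x ⊞ part pi y.
Proof. exact: (consttM pi (baddC x y : commute (x : additive G) y)). Qed.

Lemma part_act pi x g : part pi (x ◃ g) = part pi x ◃ g.
Proof. exact: esym (morph_constt (act_morph g) pi (in_setT (x : additive G))). Qed.

Lemma part_id pi x : part pi (part pi x) = part pi x.
Proof. exact: constt_p_elt (p_elt_constt pi (x : additive G)). Qed.

Lemma partE pi x : x = part pi x ⊞ part pi^' x.
Proof. exact: esym (consttC pi (x : additive G)). Qed.

Lemma part_compl pi x : part pi (part pi^' x) = 1.
Proof. exact: constt1P (p_elt_constt pi^' (x : additive G)). Qed.

Lemma part1 pi : part pi 1 = 1.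
Proof. exact: (constt1 (additive G) pi). Qed.

Lemma part_complr pi x : part pi^' (part pi x) = 1.
Proof. by apply: (@constt1P (additive G) pi^' _ _); rewrite p_eltNK p_elt_constt. Qed.

Definition pi_part pi : {set G} := [set x | part pi x == x].

Lemma pi_partP pi x : reflect (part pi x = x) (x \in pi_part pi).
Proof. by rewrite inE; exact: eqP. Qed.
Lemma part_in pi x : part pi x \in pi_part pi.
Proof. by apply/pi_partP/part_id. Qed.
Lemma pi_part_act pi x g : x \in pi_part pi -> x ◃ g \in pi_part pi.
Proof. by move/pi_partP=> e; apply/pi_partP; rewrite part_act e. Qed.
Lemma pi_partD pi x y : x \in pi_part pi -> y \in pi_part pi -> x ⊞ y \in pi_part pi.
Proof. by move=> /pi_partP ex /pi_partP ey; apply/pi_partP; rewrite partD ex ey. Qed.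

(** Since [x * y = x ⊞ (y ◃ x^-1)], any additive subgroup stable under the
    action is a multiplicative subgroup; the additive parts are stable because
    [◃ g] is an automorphism of the additive group. *)
Lemma pi_part_group_set pi : group_set (pi_part pi).
Proof.
apply/group_setP; split; first by apply/pi_partP/part1.
by move=> x y Ax Ay; rewrite mulg_badd pi_partD ?pi_part_act.
Qed.
Canonical pi_part_group pi := Group (pi_part_group_set pi).

Lemma pi_partE pi : pi_part pi = 'O_pi([set: additive G]) :> {set additive G}.
Proof.
apply/setP=> x; apply/idP/idP => [/pi_partP e|Ox].
  have px : pi.-elt (x : additive G) by rewrite -e; exact: p_elt_constt.
  suff: <[x : additive G]> \subset 'O_pi([set: additive G]) by rewrite cycle_subG.
  apply: pcore_max; first exact: px.
  by rewrite -sub_abelian_normal ?subsetT // additive_abelian.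
apply/pi_partP; apply: (@constt_p_elt (additive G)).
by apply: mem_p_elt (pcore_pgroup _ _) Ox.
Qed.

Lemma card_pi_part pi : #|pi_part pi| = (#|G|`_pi)%N.
Proof.
have := card_Hall (nilpotent_pcore_Hall pi (abelian_nil additive_abelian)).
by rewrite /= cardsT => <-; rewrite (pi_partE pi).
Qed.

(** The two group laws share their carrier, so orders can be compared: this
    supplies Hall subgroups for all sets of primes. *)
Lemma pi_part_Hall pi : pi.-Hall([set: G]) (pi_part pi).
Proof. by rewrite pHallE subsetT card_pi_part cardsT /=. Qed.

Lemma part_sum pi x y : x \in pi_part pi -> y \in pi_part pi^' ->
  part pi (x ⊞ y) = x /\ part pi^' (x ⊞ y) = y.
Proof.
move=> /pi_partP ex /pi_partP ey; split; rewrite partD.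
  by rewrite ex -ey part_compl baddr0.
by rewrite ey -ex part_complr badd0.
Qed.

Lemma badd_parts_inj pi x y x' y' : x \in pi_part pi -> y \in pi_part pi^' ->
  x' \in pi_part pi -> y' \in pi_part pi^' ->
  x ⊞ y = x' ⊞ y' -> x = x' /\ y = y'.
Proof.
move=> Ax Ay Ax' Ay' e.
have [e1 e2] := part_sum Ax Ay; have [e3 e4] := part_sum Ax' Ay'.
by split; [rewrite -e1 e e3 | rewrite -e2 e e4].
Qed.

Lemma mulg_parts pi (x : G) :
  exists2 a, a \in pi_part pi & exists2 b, b \in pi_part pi^' & x = a * b.
Proof.
exists (part pi x); first exact: part_in.
exists (part pi^' x ◃ part pi x); first by rewrite pi_part_act ?part_in.
exact: partE.
Qed.
End Parts.

(** * Ideals and subquotients *)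

Section Ideals.
Variable G : brace.
Implicit Types (x y z g h : G) (K T : {set G}) (B : {group G}).

Definition add_closed K : Prop :=
  1 \in K /\ forall x y, x \in K -> y \in K -> x ⊞ y \in K.

(** A closed nonempty subset of a finite group is a subgroup. *)
Lemma add_closed_opp K x : add_closed K -> x \in K -> bopp x \in K.
Proof.
move=> [K1 KD] Kx.
have gK : @group_set (additive G) K by apply/group_setP.
exact: (@groupVr _ (Group gK) (x : additive G) Kx).
Qed.

Definition act_stable (B : {set G}) K : Prop :=
  forall x g, x \in K -> g \in B -> x ◃ g \in K.

(** Ideals of the left ideal [B]; the last condition says that [T] acts
    trivially on [B] modulo [T], which for an action-stable additive subgroup
    amounts to normality in the multiplicative group ([ideal_normal]). *)
Record ideal (B T : {set G}) : Prop := Ideal {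
  ideal_sub : {subset T <= B};
  ideal_add : add_closed T;
  ideal_act : act_stable B T;
  ideal_mod : forall h t, h \in B -> t \in T -> exists2 t', t' \in T & h ◃ t = h ⊞ t' }.

Lemma stable_badd B x y : act_stable B B -> x \in B -> y \in B -> x ⊞ y \in B.
Proof. by move=> sB Bx By; rewrite groupM ?sB. Qed.

Lemma stable_add_closed B : act_stable B B -> add_closed B.
Proof. by move=> sB; split=> // x y; apply: stable_badd. Qed.

Lemma ideal1 B : ideal B 1.
Proof.
split.
- by move=> _ /set1gP ->; exact: group1.
- by split=> [|u v /set1gP -> /set1gP ->]; rewrite ?set11 // badd0 set11.
- by move=> u h /set1gP -> _; rewrite bact1l set11.
- by move=> h t Bh /set1gP ->; exists 1; rewrite ?set11 // bact1 baddr0.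
Qed.

Section SubQuotient.
Variables (B : {group G}) (T : {set G}).
Hypotheses (sB : act_stable B B) (idT : ideal B T).

Let TB t : t \in T -> t \in B. Proof. exact: ideal_sub. Qed.

Lemma ideal_group_set : group_set T.
Proof.
have [T1 TD] := ideal_add idT.
apply/group_setP; split=> // x y Tx Ty.
by rewrite mulg_badd TD // (ideal_act idT) // groupV TB.
Qed.
Let TG := Group ideal_group_set.

(** Multiplicative and additive cosets of an ideal are the same. *)
Lemma ideal_mulr t h : t \in T -> h \in B -> exists2 t', t' \in T & t * h = h ⊞ t'.
Proof.
move=> Tt Bh; have [_ TD] := ideal_add idT.
have [t' Tt' e] := ideal_mod idT Bh (groupVr (Tt : t \in TG)).
by exists (t ⊞ t'); rewrite ?TD // mulg_badd e baddC -baddA [t' ⊞ t]baddC.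
Qed.

Lemma ideal_normal : TG <| B.
Proof.
apply/andP; split; first by apply/subsetP=> t /TB.
apply/subsetP=> h Bh; rewrite inE; apply/subsetP=> _ /imsetP[t Tt ->].
have [t' Tt' e] := ideal_mulr Tt Bh.
by rewrite conjgE mulgA -[_ * t * h]mulgA e /badd mulKg (ideal_act idT).
Qed.

Lemma ideal_coset h h' : h \in B -> h' \in B ->
  h' * h^-1 \in T <-> (exists2 t, t \in T & h' = h ⊞ t).
Proof.
move=> Bh Bh'; split=> [Tt|[t Tt ->]].
  by have [t Tt' e] := ideal_mulr Tt Bh; exists t; rewrite // -e mulgKV.
have nTh : h^-1 \in 'N(TG) by rewrite (subsetP (normal_norm ideal_normal)) ?groupV.
have : (t ◃ h) ^ h^-1 \in TG by rewrite memJ_norm // (ideal_act idT).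
by rewrite conjgE invgK mulgA.
Qed.

Let Q : finGroupType := subg_of (B / TG)%G.
Let f (h : G) : Q := subg (B / TG)%G (coset TG h).

Let fM : {in B &, {morph f : x y / x * y}}.
Proof.
move=> x y Bx By.
have nT z : z \in B -> z \in 'N(TG) by apply/subsetP/normal_norm/ideal_normal.
by rewrite /f morphM ?nT // subgM ?mem_quotient.
Qed.

Let f_eq x y : x \in B -> y \in B -> f x = f y <-> (exists2 t, t \in T & y = x ⊞ t).
Proof.
move=> Bx By; apply: (iff_trans _ (ideal_coset Bx By)).
have nT z : z \in B -> z \in 'N(TG) by apply/subsetP/normal_norm/ideal_normal.
split=> [/(congr1 (@sgval _ _))|Txy].
  rewrite /f !subgK ?mem_quotient // => /esym/rcoset_kercosetP.
  by rewrite mem_rcoset; apply; apply: nT.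
by congr (subg _ _); apply/esym/rcoset_kercosetP; rewrite ?nT // mem_rcoset.
Qed.

Let f_surj q : exists2 h, h \in B & f h = q.
Proof.
have [h _ Bh e] := morphimP (subgP q).
by exists h; rewrite // /f -e sgvalK.
Qed.

Let lift (q : Q) : G := odflt 1 [pick h in B | f h == q].

Let liftP q : lift q \in B /\ f (lift q) = q.
Proof.
rewrite /lift; case: pickP => [h /andP[Bh /eqP] //|no].
by have [h Bh e] := f_surj q; have := no h; rewrite Bh e eqxx.
Qed.

Let f_act x x' y y' : x \in B -> x' \in B -> y \in B -> y' \in B ->
  f x = f x' -> f y = f y' -> f (x ◃ y) = f (x' ◃ y').
Proof.
move=> Bx Bx' By By' ex ey; have [_ TD] := ideal_add idT.
have [t Tt ex'] := (f_eq Bx Bx').1 ex.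
have Ts := (ideal_coset By By').2 ((f_eq By By').1 ey).
have [t1 Tt1 e1] := ideal_mod idT Bx' Ts.
rewrite -[y'](mulgKV y) bactM e1 ex'; apply/f_eq; rewrite ?sB //.
  by apply: stable_badd => //; [apply: stable_badd => //; apply: TB|apply: TB].
exists ((t ⊞ t1) ◃ y); first by rewrite (ideal_act idT) // TD.
by rewrite -bactD baddA.
Qed.

Let actQ (p q : Q) : Q := f (lift p ◃ lift q).

Let actQE x y : x \in B -> y \in B -> actQ (f x) (f y) = f (x ◃ y).
Proof.
move=> Bx By; have [Bx' ex] := liftP (f x); have [By' ey] := liftP (f y).
exact: f_act.
Qed.

Let f1 : f 1 = 1.
Proof. by apply: (mulgI (f 1)); rewrite -fM // !mulg1. Qed.

Let actQ1 p : actQ p 1 = p.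
Proof. by have [x Bx <-] := f_surj p; rewrite -f1 actQE // bact1. Qed.

Let actQM p q r : actQ p (q * r) = actQ (actQ p q) r.
Proof.
have [x Bx <-] := f_surj p; have [y By <-] := f_surj q; have [z Bz <-] := f_surj r.
by rewrite -fM // !actQE ?groupM ?sB // bactM.
Qed.

Let mulQC p q : p * actQ q p = q * actQ p q.
Proof.
have [x Bx <-] := f_surj p; have [y By <-] := f_surj q.
by rewrite !actQE // -!fM ?sB // bmulC.
Qed.

Let actQMr p q r : actQ (p * actQ q p) r = actQ p r * actQ (actQ q r) (actQ p r).
Proof.
have [x Bx <-] := f_surj p; have [y By <-] := f_surj q; have [z Bz <-] := f_surj r.
have sBD u v : u \in B -> v \in B -> u ◃ v \in B by apply: sB.
rewrite !(actQE, sBD) // -!fM ?(sBD, groupM) // !(actQE, sBD) ?groupM ?sBD //.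
by rewrite bactMr.
Qed.

(** The subquotient [B / T], presented by its projection [f], defined on all of
    [G] but meaningful on [B] only.  Its carrier is the group quotient of [B]
    by [T]; by [ideal_coset] the action is compatible with cosets. *)
Lemma subquotient_brace :
  exists (Q : brace) (f : G -> Q),
  [/\ {in B &, {morph f : x y / x * y}},
      {in B &, {morph f : x y / x ◃ y}},
      {in B &, forall x y, f x = f y <-> (exists2 t, t \in T & y = x ⊞ t)} &
      forall q, exists2 x, x \in B & f x = q].
Proof.
exists (Brace actQ1 actQM mulQC actQMr), f; split=> //.
by move=> x y Bx By; rewrite /= actQE.
Qed.

End SubQuotient.
End Ideals.

(** * Solvability and normal parts *)

Section BraceFacts.
Variable G : brace.
Implicit Types (x y z g h : G) (r : nat).

Definition bact_action := TotalAction (@bact1 G) (@bactM G).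

(** Both sides of [n * g = g * n ^ g] have an [r]-component and an
    [r']-component for the addition, as [n] and [n ^ g] are [r]-elements of the
    Hall subgroup [pi_part G r]; the [r']-components are [g ◃ n^-1] and
    [g]. *)
Lemma pcore_act_trivial r n g :
  n \in 'O_r([set: G]) -> g \in pi_part G r^' -> g ◃ n = g.
Proof.
move=> Nn Bg.
have sNA : 'O_r([set: G]) \subset pi_part G r := pcore_sub_Hall (pi_part_Hall G r).
have Nng : n ^ g \in 'O_r([set: G]).
  by rewrite memJ_norm // (subsetP (normal_norm (pcore_normal r [set: G]))) ?inE.
have e : n ⊞ (g ◃ n^-1) = (n ^ g ◃ g^-1) ⊞ g.
  by rewrite [RHS]baddC -!mulg_badd -conjgC.
have [_ eg] : n = n ^ g ◃ g^-1 /\ g ◃ n^-1 = g.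
  by apply: (badd_parts_inj (pi := r)) e; rewrite ?pi_part_act // (subsetP sNA).
by rewrite -{1}eg bactKV.
Qed.

Section Normal.
Variable r : nat.
Hypothesis trivAB : forall c g, c \in pi_part G r -> g \in pi_part G r^' -> g ◃ c = g.

(** Here [c * g] is [c ⊞ g = g * (c ◃ g)]. *)
Lemma part_conjg c g : c \in pi_part G r -> g \in pi_part G r^' -> c ^ g = c ◃ g.
Proof.
move=> Ac Bg; apply: (mulgI g); rewrite -conjgC mulg_badd trivAB ?groupV //.
by rewrite baddC.
Qed.

Lemma part_normal : pi_part G r <| [set: G].
Proof.
apply/andP; split; first exact: subsetT.
apply/subsetP=> x _; have [a Aa [b Bb ->]] := mulg_parts r x.
apply: groupM; first by rewrite (subsetP (normG (pi_part_group G r))).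
rewrite inE; apply/subsetP=> _ /imsetP[c Ac ->].
by rewrite part_conjg // pi_part_act.
Qed.
End Normal.

Lemma brace_solvable : solvable [set: G].
Proof.
by apply: solvable_Hall_subgroups => p _; exists (pi_part_group G p^'); apply: pi_part_Hall.
Qed.

Lemma brace_pcore : [set: G] != 1 -> exists2 r, prime r & 'O_r([set: G]) != 1.
Proof.
move=> ntG; have [M minM sMG] := minnormal_exists ntG (normG [set: G]).
have [nMG ntM /is_abelemP[r pr_r abM]] := minnormal_solvable minM sMG brace_solvable.
exists r => //; apply: contraNneq ntM => O1; rewrite -subG1 -O1 pcore_max //.
  exact: abelem_pgroup abM.
by apply/andP.
Qed.
End BraceFacts.

(** * Elements acting trivially modulo an ideal *)

Section RelativeSocle.
Variable G : brace.
Implicit Types (x y z g h : G).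

Section Socle.
Variables (B : {group G}) (T : {set G}).
Hypotheses (sB : act_stable B B) (idT : ideal B T).

(** The preimage in [B] of the socle of [B / T]. *)
Definition socle_mod : {set G} :=
  [set s in B | [forall h in B, bopp h ⊞ (h ◃ s) \in T]].

Lemma badd_oppK x y : bopp x ⊞ (x ⊞ y) = y.
Proof. by rewrite baddA baddNr badd0. Qed.
Lemma badd_oppKV x y : x ⊞ (bopp x ⊞ y) = y.
Proof. by rewrite baddA [x ⊞ _]baddC baddNr badd0. Qed.

Lemma diffP (K : {set G}) x y :
  reflect (exists2 t, t \in K & y = x ⊞ t) (bopp x ⊞ y \in K).
Proof.
apply: (iffP idP) => [Kd|[t Kt ->]]; last by rewrite badd_oppK.
by exists (bopp x ⊞ y); rewrite ?badd_oppKV.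
Qed.

Lemma socle_modP s :
  reflect (s \in B /\ forall h, h \in B -> exists2 t, t \in T & h ◃ s = h ⊞ t)
          (s \in socle_mod).
Proof.
rewrite inE; apply: (iffP andP) => [] [Bs sP]; split=> //.
  by move=> h Bh; apply/diffP/(forall_inP sP).
by apply/forall_inP=> h Bh; apply/diffP/sP.
Qed.

Lemma ideal_sub_socle : {subset T <= socle_mod}.
Proof.
move=> t Tt; apply/socle_modP; split; first exact: (ideal_sub idT).
by move=> h Bh; apply: (ideal_mod idT).
Qed.

Lemma socle_modM s u : s \in socle_mod -> u \in socle_mod -> s * u \in socle_mod.
Proof.
have [_ TD] := ideal_add idT.
move=> /socle_modP[Bs sP] /socle_modP[Bu uP]; apply/socle_modP.
split=> [|h Bh]; first exact: groupM.
have [t Tt e] := sP h Bh; have [v Tv ev] := uP h Bh.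
by exists (v ⊞ (t ◃ u)); [rewrite TD // (ideal_act idT)|rewrite bactM e bactD ev baddA].
Qed.

Lemma socle_modJ s g : s \in socle_mod -> g \in B -> s ^ g \in socle_mod.
Proof.
move=> /socle_modP[Bs sP] Bg; apply/socle_modP; split=> [|h Bh]; first exact: groupJ.
have [|t Tt e] := sP (h ◃ g^-1); first by rewrite sB ?groupV.
exists (t ◃ g); first exact: (ideal_act idT).
by rewrite conjgE !bactM e bactD bactKV.
Qed.

(** For additive closure, [s ⊞ u = s * (u ◃ s)] and [u ◃ s] is [u] modulo [T];
    for stability, compare [s * (g ◃ s) = s ⊞ g = g ⊞ s = g * (s ◃ g)], which
    makes [s ◃ g] equal to [s ^ g] modulo [T]. *)
Lemma socle_mod_ideal : ideal B socle_mod.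
Proof.
have sTS := ideal_sub_socle; have [T1 TD] := ideal_add idT.
split.
- by move=> s /socle_modP[].
- split=> [|s u Ss Su]; first exact: sTS.
  have [[Bs _] [Bu uP]] := (socle_modP _ Ss, socle_modP _ Su).
  have [Bs' sP] := socle_modP _ Ss.
  have [t Tt e] := sP u Bu; rewrite /badd e socle_modM // socle_modM //.
  by rewrite sTS // (ideal_act idT).
- move=> s g Ss Bg; have [Bs sP] := socle_modP _ Ss.
  have [t Tt e] := sP g Bg.
  have -> : s ◃ g = s ^ g * (t ◃ g).
    apply: (mulgI g); rewrite -/(g ⊞ s) mulgA -conjgC -mulgA -/(g ⊞ t) -e.
    exact: baddC.
  by rewrite socle_modM ?socle_modJ // sTS // (ideal_act idT).
- move=> h s Bh /socle_modP[Bs sP]; have [t Tt e] := sP h Bh.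
  by exists t => //; apply: sTS.
Qed.
End Socle.
End RelativeSocle.

(** * Equivariant generating families *)

(** The size of a homogeneous image divides the size of a homogeneous set.  The
    family of maps [h] stands for a transitive group whose action descends
    along [p]; only the equality of the fibres matters. *)
Lemma dvdn_card_equivariant (T1 T2 : finType) (S : {set T1}) (p : T1 -> T2) :
  (forall s s', s \in S -> s' \in S -> exists2 h : T1 -> T1, injective h &
     forall u, u \in S -> p u = p s -> h u \in S /\ p (h u) = p s') ->
  #|p @: S| %| #|S|.
Proof.
move=> trS; pose F v := [set u in S | p u == v].
have leF s s' : s \in S -> s' \in S -> #|F (p s)| <= #|F (p s')|.
  move=> Ss Ss'; have [h injh hP] := trS s s' Ss Ss'.
  rewrite -(card_imset _ injh) subset_leq_card //.
  apply/subsetP=> _ /imsetP[u Fu ->]; move: Fu; rewrite inE => /andP[Su /eqP eu].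
  by have [Shu ehu] := hP u Su eu; rewrite inE Shu ehu eqxx.
have [->|[s0 Ss0]] := set_0Vmem S; first by rewrite imset0 !cards0.
apply/dvdnP; exists #|F (p s0)|; rewrite -sum1_card (partition_big_imset p) /=.
rewrite mulnC -sum_nat_const; apply: eq_bigr => _ /imsetP[s Ss ->].
rewrite -(_ : #|F (p s)| = #|F (p s0)|); last first.
  by apply/eqP; rewrite eqn_leq !leF.
by rewrite -sum1_card; apply: eq_bigl => u; rewrite inE.
Qed.

Lemma square_free_dvd m n : square_free n -> m %| n -> square_free m.
Proof. by move=> sqn dv k dvk; apply: sqn; apply: dvdn_trans dvk dv. Qed.
Definition add_generates (G : brace) (A : {set G}) : Prop :=
  forall K : {set G}, add_closed K -> {subset A <= K} -> forall g, g \in K.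

Definition bact_orbit (G : brace) (x : G) : {set G} := [set x ◃ g | g in [set: G]].

(** What survives of an indecomposable solution: a faithful transitive [G]-set
    with an equivariant map to [G] whose values span [G] additively.  For a
    solution, [sig] is [d]. *)
Record spanning_set (G : brace) (xT : finType) (to : {action G &-> xT})
    (S : {set xT}) (sig : xT -> G) : Prop := SpanningSet {
  bs_trans : [transitive [set: G], on S | to];
  bs_faithful : [faithful [set: G], on S | to];
  bs_act : forall x g, x \in S -> sig (to x g) = sig x ◃ g;
  bs_gen : add_generates (sig @: S) }.

Definition has_socle (Q : brace) : Prop :=
  exists2 u : Q, u != 1 & forall h, h ◃ u = h.

Section SpanningSetTheory.
Variables (G : brace) (xT : finType) (to : {action G &-> xT}).
Variables (S : {set xT}) (sig : xT -> G).
Hypotheses (bS : spanning_set to S sig) (sqfS : square_free #|S|).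
Implicit Types (x y z : xT) (g h c : G).

Lemma bs_stable x g : x \in S -> to x g \in S.
Proof.
move=> Sx; rewrite -(atransP (bs_trans bS) x Sx); exact: mem_orbit.
Qed.

Lemma bs_connect x y : x \in S -> y \in S -> exists g, y = to x g.
Proof.
move=> Sx Sy; have [g _ e] := atransP2 (bs_trans bS) Sx Sy; by exists g.
Qed.

Lemma bs_faithfulP g : (forall x, x \in S -> to x g = x) -> g = 1.
Proof.
move=> fix_g; apply/set1gP/(subsetP (bs_faithful bS)).
rewrite inE in_setT /=; apply/astabP=> x Sx; exact: fix_g.
Qed.

Lemma bs_add_ind (P : pred G) :
  P 1 -> (forall g h, P g -> P h -> P (g ⊞ h)) ->
  (forall x, x \in S -> P (sig x)) -> forall g, P g.
Proof.
move=> P1 PD Psig g; suff: g \in [set g | P g] by rewrite inE.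
apply: (bs_gen bS).
  by split=> [|x y]; rewrite !inE //; apply: PD.
by move=> _ /imsetP[x Sx ->]; rewrite inE Psig.
Qed.

Lemma bs_acts (H : {group G}) : [acts H, on S | to].
Proof.
by apply/actsP=> g _ x; apply/idP/idP => [/(bs_stable g^-1)|/(bs_stable g)//]; rewrite actK.
Qed.

Lemma pgroup_orbit (r : nat) (P : {group G}) x : r.-group P ->
  exists k, #|orbit to P x| = (r ^ k)%N.
Proof.
move=> rP; have rO : r.-nat #|orbit to P x| := pnat_dvd (dvdn_orbit to P x) rP.
by have [k ->] := p_natP rO; exists k.
Qed.

Let A (r : nat) := pi_part_group G r.
Let B (r : nat) := pi_part_group G r^'.

Lemma part_pgroup (r : nat) : r.-group (A r).
Proof. exact: pHall_pgroup (pi_part_Hall G r). Qed.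

(** If [r ^ 2] divided the size of every orbit of this [r]-group, it would
    divide that of [S]. *)
Lemma small_orbit r : prime r -> exists2 x, x \in S & #|orbit to (pi_part G r) x| <= r.
Proof.
move=> pr_r.
case: (pickP [pred x in S | #|orbit to (A r) x| <= r]).
  by move=> x /andP[Sx le_r]; exists x.
move=> no; suff dv : r ^ 2 %| #|S| by have := sqfS dv => r1; rewrite r1 in pr_r.
rewrite -(acts_sum_card_orbit (bs_acts (A r))); apply: dvdn_sum => _ /imsetP[x Sx ->].
have := no x; rewrite /= Sx /=; have [k ->] := pgroup_orbit x (part_pgroup r).
move/negbT; rewrite -ltnNge => lt_rk; apply: dvdn_exp2l.
by rewrite -(ltn_exp2l 1 k (prime_gt1 pr_r)) expn1.
Qed.

Section FixedComponent.
Variables (r : nat) (x : xT).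
Hypotheses (pr_r : prime r) (ntN : 'O_r([set: G]) != 1).
Hypotheses (Sx : x \in S) (small : #|orbit to (pi_part G r) x| <= r).

(** The points of a transitive set that a normal subgroup fixes are all or
    none, and the action is faithful. *)
Lemma core_moves : exists2 n, n \in 'O_r([set: G]) & to x n != x.
Proof.
apply/exists_inP; apply: contraNT ntN; rewrite negb_exists_in => /forall_inP fixN.
rewrite -subG1; apply/subsetP=> n Nn; rewrite inE; apply/eqP/bs_faithfulP=> y Sy.
have [g ->] := bs_connect Sx Sy.
have Nng : n ^ g^-1 \in 'O_r([set: G]).
  by rewrite memJ_norm // (subsetP (normal_norm (pcore_normal r [set: G]))) ?inE.
by rewrite -actM conjgCV actM (eqP (negbNE (fixN _ Nng))).
Qed.

(** The orbit of the core is nontrivial, so it has at least [r] points, and it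
    is contained in an orbit of at most [r] points. *)
Lemma core_orbit : orbit to 'O_r([set: G]) x = orbit to (pi_part G r) x.
Proof.
have sNA : 'O_r([set: G]) \subset pi_part G r := pcore_sub_Hall (pi_part_Hall G r).
apply/eqP; rewrite eqEcard; apply/andP; split.
  by apply/subsetP=> _ /imsetP[n Nn ->]; rewrite mem_orbit // (subsetP sNA).
apply: leq_trans small _.
have [k ek] := pgroup_orbit x (pcore_pgroup r [set: G]); rewrite ek.
case: k ek => [|k] ek; last by rewrite expnS leq_pmulr ?expn_gt0 ?prime_gt0.
have [n Nn] := core_moves; case/negP.
have /card_le1_eqP eq1 : #|orbit to 'O_r([set: G]) x| <= 1 by rewrite ek.
by apply/eqP/(eq1 x (to x n)); [exact: orbit_refl|exact: mem_orbit].
Qed.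

(** Elements of the core fix all [r']-components by [pcore_act_trivial], and
    they reach the whole orbit of [x] under the [r]-part. *)
Lemma cofactor_fixed c : c \in pi_part G r -> part r^' (sig x) ◃ c = part r^' (sig x).
Proof.
move=> Ac; have : to x c \in orbit to 'O_r([set: G]) x by rewrite core_orbit mem_orbit.
case/imsetP=> n Nn e; rewrite -part_act -(bs_act bS) // e (bs_act bS) // part_act.
by rewrite (pcore_act_trivial Nn) ?part_in.
Qed.
End FixedComponent.

Section Cofactor.
Variables (r : nat) (x : xT).
Hypotheses (Sx : x \in S) (ntA : pi_part G r != 1).
Hypothesis (fixA : forall c, c \in pi_part G r -> part r^' (sig x) ◃ c = part r^' (sig x)).
Let b := part r^' (sig x).

Lemma cofactor_orbit y : y \in S ->
  exists2 g, g \in pi_part G r^' & part r^' (sig y) = b ◃ g.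
Proof.
move=> Sy; have [h ->] := bs_connect Sx Sy; rewrite (bs_act bS) // part_act.
by have [a Aa [g Bg ->]] := mulg_parts r h; exists g; rewrite // bactM fixA.
Qed.

Definition trivial_mod (T : {set G}) : Prop :=
  forall c g, c \in pi_part G r -> g \in pi_part G r^' ->
    exists2 t, t \in T & g ◃ c = g ⊞ t.

Lemma part_stable pi : act_stable (pi_part G pi) (pi_part G pi).
Proof. by move=> u g Bu _; apply: pi_part_act. Qed.

(** The components [b ◃ k] with [k] in [B] span [B], so it suffices to treat
    them.  Rewrite [k * c] as [c' * (k ◃ c')] with [c'] in the [r]-part; as [c']
    fixes [b], the image [(b ◃ k) ◃ c] is [b ◃ (k ◃ c')].  By hypothesis
    [k ◃ c' = k ⊞ s = k * (s ◃ k)] with [s] in the relative socle, so that the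
    image is [(b ◃ k) ◃ (s ◃ k)], which is [b ◃ k] modulo [T]. *)
Lemma trivial_mod_socle (T : {set G}) : ideal (pi_part G r^') T ->
  trivial_mod (socle_mod (pi_part G r^') T) -> trivial_mod T.
Proof.
move=> idT trivS c g Ac Bg; have [T1 TD] := ideal_add idT.
pose P h := bopp (part r^' h) ⊞ (part r^' h ◃ c) \in T.
suff: P g by rewrite /P (pi_partP _ _ Bg) => /diffP.
apply: bs_add_ind => [|h k|y Sy]; rewrite /P.
- by rewrite part1 bact1l; apply/diffP; exists 1; rewrite // baddr0.
- move=> /diffP[t Tt et] /diffP[u Tu eu].
  apply/diffP; exists (t ⊞ u); first exact: TD.
  rewrite partD bactD et eu -!baddA; congr (_ ⊞ _).
  by rewrite !baddA; congr (_ ⊞ _); rewrite baddC.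
have [k Bk ->] := cofactor_orbit Sy; apply/diffP.
have Ac' : c ◃ k^-1 \in pi_part G r by apply: pi_part_act.
have [s Ss es] := trivS _ k Ac' Bk.
have Bs : s \in pi_part G r^' by case/socle_modP: Ss.
have Ss' : s ◃ k \in socle_mod (pi_part G r^') T.
  exact: (ideal_act (socle_mod_ideal (@part_stable _) idT)).
case/socle_modP: Ss' => _ /(_ (b ◃ k)) [|t Tt et].
  by rewrite pi_part_act // part_in.
exists t => //; rewrite -et -!bactM.
have -> : k * c = (c ◃ k^-1) * (k ◃ (c ◃ k^-1)).
  by rewrite -/(badd _ _) [RHS]baddC -mulg_badd.
by rewrite es bactM fixA.
Qed.

(** The induction hypothesis of [square_free_socle], applied below to the
    subquotients of the [r']-part. *)
Hypothesis socIH : forall (Q : brace) (q : Q), #|Q| < #|G| -> 1 < #|Q| ->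
  square_free #|bact_orbit q| -> add_generates (bact_orbit q) -> has_socle Q.

Lemma cofactor_card : #|pi_part G r^'| < #|G|.
Proof.
rewrite -[X in _ < X]cardsT proper_card // properE subsetT /=.
apply: contra ntA => /subsetP TB; rewrite -subG1; apply/subsetP=> a Aa.
rewrite inE -(pi_partP _ _ Aa) -(pi_partP _ _ (TB a (in_setT a))).
by rewrite part_compl.
Qed.

(** In [B / T] the image of [b] has a spanning orbit.  That orbit is an
    equivariant image of the [B]-orbit of [b], itself an equivariant image of
    [S], so its size divides that of [S] and [socIH] applies. *)
Lemma cofactor_socle (T : {set G}) : ideal (pi_part G r^') T ->
  T != pi_part G r^' -> exists2 s, s \in socle_mod (pi_part G r^') T & s \notin T.
Proof.
move=> idT neTB; have sB := @part_stable r^'; have [T1 TD] := ideal_add idT.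
have [Q [f [fM fA fE fS]]] := subquotient_brace sB idT.
have fD u v : u \in B r -> v \in B r -> f (u ⊞ v) = f u ⊞ f v.
  by move=> Bu Bv; rewrite /badd fM ?fA ?pi_part_act.
have f1 : f 1 = 1 by apply: (mulgI (f 1)); rewrite -fM ?mulg1 ?(group1 (B r)) // mulg1.
have f0 u : u \in B r -> f u = 1 -> u \in T.
  move=> Bu; rewrite -f1 => /esym e; have [t Tt ->] := (fE 1 u (group1 (B r)) Bu).1 e.
  by rewrite badd0.
have imf : [set: Q] = f @: B r.
  by apply/setP=> q; rewrite inE; have [u Bu <-] := fS q; rewrite imset_f.
have ltQ : #|Q| < #|G|.
  by rewrite -[#|Q|]cardsT imf (leq_ltn_trans (leq_imset_card _ _)) ?cofactor_card.
have ntQ : 1 < #|Q|.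
  rewrite -cardsT cardG_gt1; apply: contraNneq neTB => Q1.
  apply/eqP/setP=> u; apply/idP/idP=> [/(ideal_sub idT) //|Bu].
  by apply: f0 => //; apply/set1gP; rewrite -Q1 inE.
have Bb : b \in B r by apply: part_in.
have orbE : bact_orbit (f b) = f @: ((fun y => part r^' (sig y)) @: S).
  apply/setP=> q; apply/imsetP/imsetP=> [[p _ ->]|[_ /imsetP[y Sy ->] ->]].
    have [u Bu <-] := fS p; exists (b ◃ u); last by rewrite fA.
    apply/imsetP; exists (to x u); first exact: bs_stable.
    by rewrite (bs_act bS) // part_act.
  by have [g Bg ->] := cofactor_orbit Sy; exists (f g); rewrite ?inE ?fA.
have [||||q ntq qP] := socIH (q := f b) => //.
- apply: square_free_dvd sqfS _; rewrite orbE.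
  apply: (@dvdn_trans #|(fun y => part r^' (sig y)) @: S|); apply: dvdn_card_equivariant.
    move=> _ _ /imsetP[y Sy ->] /imsetP[z Sz ->].
    have [g Bg eg] := cofactor_orbit Sy; have [h Bh eh] := cofactor_orbit Sz.
    exists (fun u => u ◃ (g^-1 * h)); first exact: bact_inj.
    have Bgh : g^-1 * h \in B r by rewrite groupM ?groupV.
    move=> _ /imsetP[v Sv ->] ev; split.
      apply/imsetP; exists (to v (g^-1 * h)); first exact: bs_stable.
      by rewrite (bs_act bS) // part_act.
    by rewrite fA ?part_in // ev -fA ?part_in // eg eh bactM bactK.
  move=> y z Sy Sz; have [g ->] := bs_connect Sy Sz.
  exists (to^~ g); first exact: act_inj.
  move=> u Su e; split; first exact: bs_stable.
  by rewrite !(bs_act bS) // !part_act e.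
- move=> K [K1 KD] sK q.
  have [u Bu <-] := fS q; rewrite -(pi_partP _ _ Bu).
  apply: (@bs_add_ind (fun g => f (part r^' g) \in K)) => [|g h Kg Kh|y Sy].
  + by rewrite part1 f1.
  + by rewrite partD fD ?part_in //; apply: KD.
  apply: sK; rewrite orbE; apply/imsetP.
  by exists (part r^' (sig y)) => //; apply/imsetP; exists y.
have [s Bs es] := fS q; exists s.
  apply/socle_modP; split=> // h Bh; apply/fE; rewrite ?pi_part_act //.
  by rewrite fA // es qP.
apply: contraNN ntq => Ts; rewrite -es -f1 eq_sym; apply/eqP/fE => //.
by exists s; rewrite ?badd0.
Qed.

(** Every action is trivial modulo [B].  By [trivial_mod_socle] triviality
    descends from a term of the relative socle series of [B] to the previous
    one; by [cofactor_socle] the series increases strictly until it reaches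
    [B].  The induction climbs the series, carrying along that triviality modulo
    the current term [T] implies triviality modulo [1]. *)
Lemma act_trivial_cofactor c g :
  c \in pi_part G r -> g \in pi_part G r^' -> g ◃ c = g.
Proof.
suff main n (T : {set G}) : ideal (pi_part G r^') T -> #|pi_part G r^'| - #|T| < n ->
    (trivial_mod T -> trivial_mod 1) -> trivial_mod 1.
  move=> Ac Bg; have [t /set1gP -> ->] := main _ 1 (ideal1 (B r)) (ltnSn _) id c g Ac Bg.
  exact: baddr0.
elim: n T => // n IHn T idT /ltnSE le_n triv1.
have [TB|neTB] := eqVneq T (pi_part G r^').
  apply: triv1 => a h Aa Bh; exists (bopp h ⊞ (h ◃ a)); last by rewrite badd_oppKV.
  have aB := stable_add_closed (B := B r) (@part_stable r^'); have [_ BD] := aB.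
  rewrite TB; apply: BD; first exact: (add_closed_opp aB).
  exact: pi_part_act.
have idS := socle_mod_ideal (B := B r) (@part_stable r^') idT.
apply: (IHn _ idS); last by move=> trivS; apply: triv1; apply: trivial_mod_socle.
have [s Ss nTs] := cofactor_socle idT neTB.
have sTS : T \proper socle_mod (pi_part G r^') T.
  apply/properP; split; last by exists s.
  by apply/subsetP/(ideal_sub_socle idT).
have leSB : #|socle_mod (pi_part G r^') T| <= #|pi_part G r^'|.
  by apply/subset_leq_card/subsetP/(ideal_sub idS).
apply: leq_trans le_n; apply: ltn_sub2l; last exact: proper_card.
exact: leq_trans (proper_card sTS) leSB.
Qed.
End Cofactor.

End SpanningSetTheory.

(** * A normal part acts trivially on itself *)

Section NormalPart.
Variables (G : brace) (xT : finType) (to : {action G &-> xT}).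
Variables (S : {set xT}) (sig : xT -> G).
Hypotheses (bS : spanning_set to S sig).
Implicit Types (x y z : xT) (g h c : G).
Variable r : nat.
Hypotheses (pr_r : prime r) (ntA : pi_part G r != 1).
Hypothesis trivAB : forall c g, c \in pi_part G r -> g \in pi_part G r^' -> g ◃ c = g.
Hypothesis small : forall x, x \in S -> #|orbit to (pi_part G r) x| <= r.
Let A := pi_part_group G r.

Let nA g c : c \in A -> c ^ g \in A.
Proof.
move=> Ac; rewrite memJ_norm //.
by rewrite (subsetP (normal_norm (part_normal trivAB))) ?inE.
Qed.

Lemma small_index x : x \in S -> #|A : 'C_A[x | to]| <= r.
Proof. by move=> Sx; rewrite -card_orbit small. Qed.

(** Each stabiliser in the [r]-group [A] has index [1] or [r], so it contains
    the Frattini subgroup of [A], which therefore acts trivially. *)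
Lemma part_abelem : r.-abelem A.
Proof.
rewrite -(trivg_Phi (part_pgroup G r)) -subG1; apply/subsetP=> c Pc.
rewrite inE; apply/eqP/(bs_faithfulP bS)=> x Sx.
have sCA : 'C_A[x | to] \subset A := subsetIl _ _.
suff: 'Phi(A) \subset 'C_A[x | to].
  by move/subsetP/(_ c Pc); rewrite inE => /andP[_ /astab1P].
have [k ek] := pgroup_orbit to x (part_pgroup G r).
move: (small Sx); rewrite ek; case: k ek => [|[|k]] ek.
- move=> _; have /eqP := ek; rewrite card_orbit indexg_eq1 => sAC.
  exact: subset_trans (Phi_sub _) sAC.
- move=> _; apply/Phi_sub_max/(p_index_maximal sCA).
  by rewrite -card_orbit ek expn1.
by rewrite -[X in _ <= X]expn1 leq_exp2l ?prime_gt1.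
Qed.

(** Suppose that not all components [part r (sig x)] are fixed by [A]; by
    transitivity none is.  The stabiliser of [part r (sig x)] then has index at
    least [r] and contains the stabiliser of [x], so the two agree.  Let [u] be
    a nontrivial fixed point of the [r]-group [A] acting on itself.  Since [A]
    is commutative, [u * a = a * u] for [a = part r (sig x)], which in additive
    terms reads [u ⊞ (a ◃ u^-1) = a ⊞ u]: so [u] stabilises [a], hence fixes
    [x], for every [x]. *)
Lemma act_trivial_part c a : c \in pi_part G r -> a \in pi_part G r -> a ◃ c = a.
Proof.
have [/exists_inP[x Sx /forall_inP fixx]|] :=
    boolP [exists x in S, [forall c in A, part r (sig x) ◃ c == part r (sig x)]].
  move=> Ac Aa; rewrite -(pi_partP _ _ Aa) -part_act.
  apply/eqP; apply: (bs_add_ind bS (P := fun g => part r (g ◃ c) == part r g)).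
  - by rewrite bact1l.
  - by move=> g h /eqP eg /eqP eh; rewrite bactD !partD eg eh.
  move=> y Sy; have [g ->] := bs_connect bS Sx Sy.
  rewrite (bs_act bS) // -bactM conjgCV bactM !part_act.
  by rewrite (eqP (fixx _ _)) ?nA.
rewrite negb_exists_in => /forall_inP mvS.
have stabE x c0 : x \in S -> c0 \in A ->
    part r (sig x) ◃ c0 = part r (sig x) -> to x c0 = x.
  move=> Sx Ac0 fixc0.
  have sCD : 'C_A[x | to] \subset 'C_A[part r (sig x) | bact_action G].
    apply/subsetP=> c1; rewrite !inE !sub1set !inE => /andP[-> /eqP e] /=.
    by rewrite -part_act -(bs_act bS) // e.
  have sDA : 'C_A[part r (sig x) | bact_action G] \subset A := subsetIl _ _.
  have [k ek] := pgroup_orbit (bact_action G) (part r (sig x)) (part_pgroup G r).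
  have lt1k : 0 < k.
    rewrite lt0n; apply: contra (mvS x Sx) => /eqP k0.
    move/eqP: ek; rewrite k0 expn0 card_orbit indexg_eq1 => /subsetP sAC.
    by apply/forall_inP=> c1 /sAC; rewrite inE => /andP[_ /astab1P /= ->].
  have ge_r : r <= #|A : 'C_A[part r (sig x) | bact_action G]|.
    by rewrite -card_orbit ek -(prednK lt1k) expnS leq_pmulr ?expn_gt0 ?prime_gt0.
  have eCD : 'C_A[x | to] = 'C_A[part r (sig x) | bact_action G].
    apply/eqP; rewrite eqEcard sCD /=.
    have := leq_trans (small_index Sx) ge_r.
    rewrite -(leq_pmul2l (cardG_gt0 'C_A[x | to])) Lagrange ?subsetIl //.
    by rewrite -(Lagrange sDA) leq_pmul2r.
  suff: c0 \in 'C_A[x | to] by rewrite inE => /andP[_ /astab1P].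
  by rewrite eCD inE Ac0; apply/astab1P.
have actA : [acts A, on A | bact_action G].
  apply/actsP=> g _ u /=; apply/idP/idP=> [|Au]; last exact: pi_part_act.
  by move/(pi_part_act g^-1); rewrite bactK.
have := pgroup_fix_mod (part_pgroup G r) actA.
have rA : r %| #|A|.
  by have [] := pgroup_pdiv (part_pgroup G r) ntA.
move/eqP; rewrite (eqP (rA : _ %% _ == 0)) eq_sym => rF.
have F1 : 1 \in 'Fix_(A | bact_action G)(A).
  by rewrite inE group1; apply/afixP=> c0 _; apply: bact1l.
have [u] : exists2 u, u \in 'Fix_(A | bact_action G)(A) & u != 1.
  apply/exists_inP; apply: contraLR (prime_gt1 pr_r).
  rewrite negb_exists_in => /forall_inP all1.
  rewrite -leqNgt; apply: leq_trans (dvdn_leq _ rF) _.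
    by rewrite (cardD1 1) F1.
  rewrite -[X in _ <= X](cards1 (1 : G)) subset_leq_card //.
  by apply/subsetP=> v /all1; rewrite negbK inE.
rewrite inE => /andP[Au /afixP fixu]; case/negP.
apply/eqP/(bs_faithfulP bS)=> x Sx; apply: (canLR (actKV to u)); apply/esym.
apply: stabE; rewrite ?groupV //.
have Ax : part r (sig x) \in A := part_in _ _.
have: u * part r (sig x) = part r (sig x) * u.
  by apply: (centsP (abelem_abelian part_abelem)).
have /= fixu' := fixu _ (groupVr Ax).
rewrite (mulg_badd u) (mulg_badd (part r _)) fixu' [_ ⊞ u]baddC.
by move/(congr1 (badd (bopp u))); rewrite !badd_oppK.
Qed.
End NormalPart.

(** * Braces spanned by a square-free orbit have a socle *)

Section CentralPart.
Variables (G : brace) (xT : finType) (to : {action G &-> xT}).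
Variables (S : {set xT}) (sig : xT -> G).
Hypotheses (bS : spanning_set to S sig) (sqfS : square_free #|S|).
Implicit Types (x y z : xT) (g h c : G).

Lemma orbit_act (A : {group G}) x g : A <| [set: G] ->
  orbit to A (to x g) = to^~ g @: orbit to A x.
Proof.
move=> nA; have nAg c h : c \in A -> c ^ h \in A.
  by move=> Ac; rewrite memJ_norm // (subsetP (normal_norm nA)) ?inE.
apply/setP=> y; apply/imsetP/imsetP => [[c Ac ->]|[_ /imsetP[c Ac ->] ->]].
  exists (to x (c ^ g^-1)); first by rewrite mem_orbit ?nAg.
  by rewrite -!actM -conjgCV.
by exists (c ^ g); rewrite ?nAg // -!actM -conjgC.
Qed.

Hypothesis socIH : forall (Q : brace) (q : Q), #|Q| < #|G| -> 1 < #|Q| ->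
  square_free #|bact_orbit q| -> add_generates (bact_orbit q) -> has_socle Q.

(** The prime [r] is chosen so that the largest normal [r]-subgroup is
    nontrivial, which is where solvability enters. *)
Lemma central_part : [set: G] != 1 ->
  exists r : nat, [/\ prime r, pi_part G r != 1,
    forall c h, c \in pi_part G r -> h ◃ c = h &
    forall x, x \in S -> #|orbit to (pi_part G r) x| = r].
Proof.
move=> ntG; have [r pr_r ntN] := brace_pcore ntG.
have [x Sx small] := small_orbit bS sqfS pr_r.
have sNA : 'O_r([set: G]) \subset pi_part G r := pcore_sub_Hall (pi_part_Hall G r).
have ntA : pi_part G r != 1.
  by apply: contraNneq ntN => A1; rewrite -subG1 -A1.
have trivAB := act_trivial_cofactor bS sqfS Sx ntA
  (cofactor_fixed bS pr_r ntN Sx small) socIH.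
have nA := part_normal trivAB.
have orb_r y : y \in S -> #|orbit to (pi_part G r) y| = r.
  move=> Sy; have [g ->] := bs_connect bS Sx Sy.
  rewrite (orbit_act (A := pi_part_group G r)) // card_imset; last exact: act_inj.
  apply/eqP; rewrite eqn_leq small /=.
  have [n Nn mv] := core_moves bS ntN Sx.
  have [[|k] ek] := pgroup_orbit to x (part_pgroup G r); last first.
    by rewrite ek expnS leq_pmulr ?expn_gt0 ?prime_gt0.
  case/negP: mv; have /card_le1_eqP eq1 : #|orbit to (pi_part G r) x| <= 1 by rewrite ek.
  apply/eqP/(eq1 x (to x n)); first exact: orbit_refl (pi_part_group G r) _.
  by rewrite mem_orbit // (subsetP sNA).
have small_r y : y \in S -> #|orbit to (pi_part G r) y| <= r by move/orb_r ->.
exists r; split=> // c h Ac; rewrite (partE r h) bactD (trivAB _ _ Ac (part_in _ _)).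
by rewrite (act_trivial_part bS pr_r ntA trivAB small_r Ac (part_in _ _)).
Qed.
End CentralPart.

(** If the action on the orbit of [q] is not faithful, an element of its kernel
    acts trivially on the additive span of the orbit, which is everything.
    Otherwise the orbit itself, with the identity map, is a spanning set and
    [central_part] applies. *)
Theorem square_free_socle (Q : brace) (q : Q) : 1 < #|Q| ->
  square_free #|bact_orbit q| -> add_generates (bact_orbit q) -> has_socle Q.
Proof.
have [n] := ubnP #|Q|; elim: n => // n IHn in Q q * => /ltnSE leQn gt1Q sqf gen.
have socIH (Q' : brace) (q' : Q') : #|Q'| < #|Q| -> 1 < #|Q'| ->
    square_free #|bact_orbit q'| -> add_generates (bact_orbit q') -> has_socle Q'.
  by move=> ltQ'; apply: IHn; apply: leq_trans ltQ' leQn.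
have ntQ : [set: Q] != 1 by rewrite -cardG_gt1 cardsT.
have [faith|] := boolP [faithful [set: Q], on bact_orbit q | bact_action Q].
  have bQ : spanning_set (bact_action Q) (bact_orbit q) id.
    split=> //; last by rewrite imset_id.
    by apply/imsetP; exists q; rewrite // -{1}(bact1 q) imset_f ?inE.
  have [r [pr_r ntA trivA _]] := central_part bQ sqf socIH ntQ.
  have [u Au ntu] := trivgPn _ ntA.
  by exists u => // h; apply: trivA.
rewrite /faithful subG1 => /trivgPn[u]; rewrite inE => /andP[_ /astabP fixu] ntu.
exists u => // h; suff: h \in [set h | h ◃ u == h] by rewrite inE => /eqP.
apply: gen => [|y Oy]; last by rewrite inE; apply/eqP/fixu.
split=> [|y z]; rewrite !inE ?bact1l //.
by move=> /eqP ey /eqP ez; rewrite bactD ey ez.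
Qed.

(** * The additive exponent *)

Definition multiple (G : brace) (n : nat) (x : G) : G := (x : additive G) ^+ n.

Section Multiples.
Variable G : brace.
Implicit Types x y : G.

Lemma multiple0 x : multiple 0 x = 1. Proof. by []. Qed.
Lemma multipleS n x : multiple n.+1 x = x ⊞ multiple n x.
Proof. exact: (expgS (x : additive G) n). Qed.
Lemma multipleD n x y : multiple n (x ⊞ y) = multiple n x ⊞ multiple n y.
Proof. exact: (expgMn n (baddC x y : commute (x : additive G) y)). Qed.
Lemma multiple1 n : multiple n (1 : G) = 1.
Proof. exact: (expg1n (additive G) n). Qed.
Lemma multipleM m n x : multiple (m * n) x = multiple n (multiple m x).
Proof. exact: (expgM (x : additive G) m n). Qed.
End Multiples.

Section OrbitQuotient.
Variables (G : brace) (xT : finType) (to : {action G &-> xT}).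
Variables (S : {set xT}) (sig : xT -> G).
Hypotheses (bS : spanning_set to S sig).
Variable r : nat.
Hypothesis pr_r : prime r.
Hypothesis trivA : forall c h, c \in pi_part G r -> h ◃ c = h.
Hypothesis orb_r : forall x, x \in S -> #|orbit to (pi_part G r) x| = r.
Implicit Types (x y z : xT) (g h c k : G).
Let A := pi_part_group G r.
Let B := pi_part_group G r^'.

Let trivAB c g : c \in pi_part G r -> g \in pi_part G r^' -> g ◃ c = g.
Proof. by move=> Ac _; apply: trivA. Qed.
Let nA : A <| [set: G] := part_normal trivAB.

Lemma central_abelem : r.-abelem A.
Proof. by apply: (part_abelem bS) => // x Sx; rewrite orb_r. Qed.

(** The [A]-component of [sig x] depends only on the [A]-orbit of [x], so an
    element [k] of [B] preserving these orbits acts trivially on [A], that is,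
    commutes with it.  On the orbit of [x] it then agrees with an element of
    [A], so that [k ^+ r] acts trivially; but the order of [k] is prime to
    [r]. *)
Lemma cofactor_faithful k : k \in B ->
  (forall x, x \in S -> to x k \in orbit to A x) -> k = 1.
Proof.
move=> Bk orbk.
have fixk a : part r a ◃ k = part r a.
  rewrite -part_act; apply/eqP.
  apply: (bs_add_ind bS (P := fun g => part r (g ◃ k) == part r g)) => [|g h|x Sx].
  - by rewrite bact1l.
  - by move=> /eqP eg /eqP eh; rewrite bactD !partD eg eh.
  have /imsetP[c Ac e] := orbk x Sx.
  by rewrite -(bs_act bS) // e (bs_act bS) // trivA.
have commk c : c \in A -> c * k = k * c.
  move=> Ac; rewrite conjgC (part_conjg trivAB) //.
  by rewrite -{1}(pi_partP _ _ Ac) fixk (pi_partP _ _ Ac).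
have [_ expA] := abelemP pr_r central_abelem.
suff kr : k ^+ r = 1.
  have r'k : r^'.-elt k := mem_p_elt (pHall_pgroup (pi_part_Hall G r^')) Bk.
  have ok : #[k] %| r by rewrite order_dvdn kr.
  apply/eqP; rewrite -order_eq1 -dvdn1 -(eqnP (_ : coprime r #[k])).
    by rewrite dvdn_gcd ok /=.
  by apply: pnat_coprime r'k; apply: pnat_id.
apply: (bs_faithfulP bS) => x Sx; have /imsetP[c Ac e] := orbk x Sx.
suff toX m : to x (k ^+ m) = to x (c ^+ m) by rewrite toX expA // act1.
elim: m => [|m IHm]; first by rewrite !expg0.
by rewrite expgSr actM IHm -actM commk ?groupX // actM e -actM -expgS.
Qed.

Let S' := orbit to A @: S.
(** The brace [Q] is a copy of [B]; it acts on the set [S'] of the orbits of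
    [A] through [lift], the inverse of [f]. *)
Variables (Q : brace) (f : G -> Q).
Hypotheses (fM : {in B &, {morph f : x y / x * y}})
  (fA : {in B &, {morph f : x y / x ◃ y}})
  (f_inj : {in B &, injective f})
  (f_surj : forall q, exists2 h, h \in B & f h = q).

Let lift (q : Q) : G := odflt 1 [pick h in B | f h == q].
Let liftP q : lift q \in B /\ f (lift q) = q.
Proof.
rewrite /lift; case: pickP => [h /andP[Bh /eqP] //|no].
by have [h Bh e] := f_surj q; have := no h; rewrite Bh e eqxx.
Qed.
Let liftK g : g \in B -> lift (f g) = g.
Proof. by move=> Bg; have [Bl e] := liftP (f g); apply: f_inj. Qed.
Let f1 : f 1 = 1.
Proof. by apply: (mulgI (f 1)); rewrite -fM // !mulg1. Qed.
Let liftM p q : lift (p * q) = lift p * lift q.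
Proof.
have [[Bp ep] [Bq eq]] := (liftP p, liftP q).
by rewrite -{1}ep -{1}eq -fM // liftK ?groupM.
Qed.

Let act' (U : {set xT}) (q : Q) : {set xT} := to^~ (lift q) @: U.
Let act'1 U : act' U 1 = U.
Proof.
rewrite /act' -f1 liftK //; apply/setP=> y; apply/imsetP/idP=> [[z Uz ->]|Uy].
  by rewrite act1.
by exists y; rewrite ?act1.
Qed.
Let act'M U p q : act' U (p * q) = act' (act' U p) q.
Proof.
by rewrite /act' -imset_comp liftM; apply: eq_imset => y /=; rewrite actM.
Qed.
Let to' : {action Q &-> {set xT}} := TotalAction act'1 act'M.

Let act'_orbit x q : to' (orbit to A x) q = orbit to A (to x (lift q)).
Proof. by rewrite /= /act' orbit_act. Qed.

Variable x0 : xT.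
Hypothesis Sx0 : x0 \in S.
Let sig' (U : {set xT}) : Q := f (part r^' (sig (odflt x0 [pick y in U]))).

Let sig'_orbit x : x \in S -> sig' (orbit to A x) = f (part r^' (sig x)).
Proof.
move=> Sx; rewrite /sig'; case: pickP => [y|/(_ x)]; last by rewrite /= orbit_refl.
by case/imsetP=> c Ac -> /=; rewrite (bs_act bS) // trivA.
Qed.

Let fD g h : g \in B -> h \in B -> f (g ⊞ h) = f g ⊞ f h.
Proof. by move=> Bg Bh; rewrite /badd fM ?fA // pi_part_act. Qed.

(** The group is [A * B] and [A] preserves its own orbits, hence transitivity
    of [B]; faithfulness is [cofactor_faithful]. *)
Lemma orbit_spanning_set : spanning_set to' S' sig'.
Proof.
split.
- apply/imsetP; exists (orbit to A x0); first exact: imset_f.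
  apply/setP=> U; apply/imsetP/imsetP=> [[x Sx ->]|[q _ ->]]; last first.
    by exists (to x0 (lift q)); [apply: (bs_stable bS)|rewrite act'_orbit].
  have [g ->] := bs_connect bS Sx0 Sx; have [a Aa [b Bb ->]] := mulg_parts r g.
  exists (f b); rewrite ?inE // act'_orbit liftK // actM !orbit_act //.
  have /orbit_eqP eA : to x0 a \in orbit to A x0 := mem_orbit to x0 Aa.
  by rewrite -orbit_act // eA.
- rewrite /faithful subG1; apply/trivgPn=> -[q]; rewrite inE => /andP[_ /astabP fixq].
  case/eqP; have [Bq eq] := liftP q; rewrite -eq -[RHS]f1; congr f.
  apply: cofactor_faithful => // x Sx.
  by have := fixq _ (imset_f _ Sx); rewrite act'_orbit => <-; apply: orbit_refl.
- move=> _ q /imsetP[x Sx ->]; have [Bq eq] := liftP q.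
  rewrite act'_orbit !sig'_orbit // ?(bs_stable bS) // (bs_act bS) // part_act.
  by rewrite fA ?part_in ?eq.
move=> K [K1 KD] sK q; have [u Bu <-] := f_surj q; rewrite -(pi_partP _ _ Bu).
apply: (bs_add_ind bS (P := fun g => f (part r^' g) \in K)) => [|g h Kg Kh|y Sy].
- by rewrite part1 f1.
- by rewrite partD fD ?part_in //; apply: KD.
by apply: sK; rewrite -sig'_orbit //; apply/imset_f/imset_f.
Qed.

Lemma card_orbit_quotient : #|S| = (#|S'| * r)%N.
Proof.
rewrite -(acts_sum_card_orbit (bs_acts bS A)) -sum_nat_const.
by apply: eq_bigr => _ /imsetP[x Sx ->]; apply: orb_r.
Qed.

(** On [A] the two group laws agree, so the exponent [r] of [A] is also its
    additive exponent. *)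
Lemma multiple_orbit_quotient n :
  (forall q : Q, multiple n q = 1) -> forall g, multiple (n * r) g = 1.
Proof.
move=> Qn g; have [_ expA] := abelemP pr_r central_abelem.
have mulB m b : b \in B -> multiple m b \in B /\ f (multiple m b) = multiple m (f b).
  move=> Bb; elim: m => [|m [Bm em]]; first by rewrite !multiple0 group1 f1.
  by rewrite !multipleS fD // em; split=> //; apply: pi_partD.
have mulA m a : a \in A -> multiple m a = a ^+ m.
  move=> Aa; elim: m => [|m IHm] //.
  by rewrite multipleS IHm expgS /badd trivA.
have Aa : part r g \in A := part_in _ _.
have [Bn en] := mulB n (part r^' g) (part_in _ _).
rewrite (partE r g) multipleD (multipleM n r (part r^' g)) (mulnC n) multipleM.
rewrite (mulA r _ Aa) expA // multiple1 badd0.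
by rewrite (f_inj Bn (group1 _)) ?multiple1 // en Qn f1.
Qed.
End OrbitQuotient.

(** Induction on the order of [G], passing from [S] to the set of the orbits of
    a central part, on which the complementary part acts as a smaller brace. *)
Theorem square_free_exponent (G : brace) (xT : finType) (to : {action G &-> xT})
    (S : {set xT}) (sig : xT -> G) :
  spanning_set to S sig -> square_free #|S| -> forall g : G, multiple #|S| g = 1.
Proof.
have [n] := ubnP #|G|; elim: n => // n IHn in G xT to S sig * => /ltnSE leGn bS sqf g.
have [G1|ntG] := eqVneq [set: G] 1.
  have -> : g = 1 by apply/set1gP; rewrite -G1 inE.
  exact: multiple1.
have socIH (Q : brace) (q : Q) : #|Q| < #|G| -> 1 < #|Q| ->
    square_free #|bact_orbit q| -> add_generates (bact_orbit q) -> has_socle Q.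
  by move=> _; apply: square_free_socle.
have [r [pr_r ntA trivA orb_r]] := central_part bS sqf socIH ntG.
have [Q [f [fM fA fE fS]]] := subquotient_brace (@part_stable G r^')
  (ideal1 (pi_part_group G r^')).
have f_inj : {in pi_part_group G r^' &, injective f}.
  by move=> u v Bu Bv /fE[]// t /set1gP -> ->; rewrite baddr0.
have [x0 Sx0] : exists x0, x0 \in S by case/imsetP: (bs_trans bS) => x Sx _; exists x.
have bS' := orbit_spanning_set bS pr_r trivA orb_r fM fA f_inj fS Sx0.
have eS := card_orbit_quotient bS orb_r.
rewrite eS; apply: (multiple_orbit_quotient bS pr_r trivA orb_r fM fA f_inj).
apply: IHn bS' _; last first.
  by apply: square_free_dvd sqf _; rewrite eS dvdn_mulr.
apply: leq_trans leGn; rewrite -[#|Q|]cardsT.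
have -> : [set: Q] = f @: pi_part G r^'.
  by apply/setP=> q; rewrite inE; have [u Bu <-] := fS q; rewrite imset_f.
exact: leq_ltn_trans (leq_imset_card _ _) (cofactor_card ntA).
Qed.

(** * The brace of a solution *)

Lemma perm_foldl (T : Type) (I : eqType) (op : T -> I -> T) :
  (forall g x y, op (op g x) y = op (op g y) x) ->
  forall s t, perm_eq s t -> forall g, foldl op g s = foldl op g t.
Proof.
move=> opC; have mv x t1 : forall g t2,
    foldl op g (t1 ++ x :: t2) = foldl op (op g x) (t1 ++ t2).
  by elim: t1 => //= y t1 IHt g t2; rewrite IHt opC.
elim=> [|x s IHs] t.
  by rewrite perm_sym => /perm_nilP ->.
move=> pst; have: x \in t by rewrite -(perm_mem pst) mem_head.
move: pst => + /splitPr xt; case: xt => t1 t2 pst g; rewrite mv /=; apply: IHs.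
rewrite -(perm_cons x); apply: perm_trans pst _.
exact: permEl (perm_catCA t1 [:: x] t2).
Qed.

Section SolutionBrace.
Variables (X : finType) (S : solution X).
Implicit Types (x y z : X) (s t : seq X) (g h : {perm X}).

Definition left_div x : {perm X} := (sigma S x)^-1.
Local Notation d := left_div.

Lemma left_divE x y : d x y = dot S x y. Proof. by []. Qed.

Lemma sigmaE x y : sigma S x y = (sol_r S (x, y)).1.
Proof. by rewrite permE. Qed.

(** Put [b = d x y] and [t = d y x].  Then [r (x, b) = (y, t)], the second
    component because [r] is involutive, and the first component of the braid
    relation at [(x, b, c)] reads
    [sigma x (sigma b c) = sigma y (sigma t c)]. *)
Lemma left_div_cycle x y : d x * d (d x y) = d y * d (d y x).
Proof.
pose b := d x y; have eb : sigma S x b = y by rewrite /b /left_div permKV.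
pose t := (sol_r S (x, b)).2.
have er : sol_r S (x, b) = (y, t) by rewrite [LHS]surjective_pairing -sigmaE eb.
have et : t = d y x.
  apply: (canRL (permK (sigma S y))).
  by rewrite sigmaE -er sol_invol.
rewrite -et /left_div -!invMg; congr (_^-1).
apply/permP=> c; rewrite !permM.
have := congr1 (fun u => u.1.1) (sol_braid S (x, b, c)).
rewrite /= er /= [sol_r S (x, _)]surjective_pairing /= -!sigmaE => ->.
by [].
Qed.

(** One step in the reading of a multiset: [g] is the permutation read so
    far, and the next point [x] is moved along by it. *)
Definition mset_op g x := g * d (g x).
Definition mset_perm s := foldl mset_op 1 s.
Local Notation D := mset_perm.

Lemma mset_op_foldl g s : foldl mset_op g s = g * D (map g s).
Proof.
have [n] := ubnP (size s); elim: n s g => // n IHn [|x s] g /ltnSE le_s.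
  by rewrite /mset_perm /= mulg1.
rewrite /mset_perm /= !IHn ?size_map // /mset_op mul1g perm1 mulgA.
by congr (_ * D _); rewrite -map_comp; apply: eq_map => y; rewrite /= permM.
Qed.

Lemma mset_perm_cat s t : D (s ++ t) = D s * D (map (D s) t).
Proof. by rewrite /mset_perm foldl_cat mset_op_foldl. Qed.

Lemma mset_perm_cons x s : D (x :: s) = d x * D (map (d x) s).
Proof. by rewrite -cat1s mset_perm_cat /mset_perm /= /mset_op mul1g perm1. Qed.

Lemma mset_perm1 x : D [:: x] = d x.
Proof. by rewrite mset_perm_cons mulg1. Qed.

Lemma mset_perm_perm s t : perm_eq s t -> D s = D t.
Proof.
move=> pst; apply: perm_foldl pst 1 => g x y.
by rewrite /mset_op -!mulgA !permM left_div_cycle.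
Qed.

(** The permutation of [map g s] is determined by those of [g] and [s], because
    the multiset union of [m] and [s] can be read starting with either part;
    hence the action of the group on itself. *)
Lemma mset_perm_map g s t : (exists m, g = D m) -> D s = D t ->
  D (map g s) = D (map g t).
Proof.
case=> m -> est; apply: (mulgI (D m)); rewrite -!mset_perm_cat.
rewrite (mset_perm_perm (permEl (perm_catC m s))).
by rewrite (mset_perm_perm (permEl (perm_catC m t))) !mset_perm_cat est.
Qed.

Local Notation Gam := (permutation_group S).

Lemma left_div_in x : d x \in Gam.
Proof. by rewrite groupV mem_gen // imset_f. Qed.

Lemma mset_perm_in s : D s \in Gam.
Proof.
have [n] := ubnP (size s); elim: n s => // n IHn [|x s] /ltnSE le_s; first exact: group1.
by rewrite mset_perm_cons groupM ?left_div_in // IHn ?size_map.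
Qed.

Lemma mset_permM s t : exists u, D s * D t = D u.
Proof.
exists (s ++ map (D s)^-1 t); rewrite mset_perm_cat -map_comp.
by rewrite (@eq_map _ _ _ id) ?map_id // => y /=; rewrite permKV.
Qed.

(** Products of values [D s] are again of that form, and [sigma x] is a
    power of its inverse [d x]. *)
Lemma mset_perm_surj g : g \in Gam -> exists s, g = D s.
Proof.
have expD s n : exists u, D s ^+ n = D u.
  elim: n => [|n [u IHn]]; first by exists [::].
  by rewrite expgS IHn; apply: mset_permM.
case/gen_prodgP=> n [c cP ->]; elim: n c cP => [|n IHn] c cP.
  by exists [::]; rewrite big_ord0.
rewrite big_ord_recl; have [|u ->] := IHn (fun i => c (lift ord0 i)); first by move=> i.
have /imsetP[x _ ->] := cP ord0.
have [v ev] := expD [:: x] #[d x].-1.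
have -> : sigma S x = D v.
  by rewrite -ev mset_perm1 -invg_expg /left_div invgK.
exact: mset_permM.
Qed.

Let GT : finGroupType := subg_of Gam.

Lemma subg_mset_surj (g : GT) : exists s, val g == D s.
Proof. by have [s es] := mset_perm_surj (subgP g); exists s; apply/eqP. Qed.

Let rep (g : GT) : seq X := xchoose (subg_mset_surj g).
Let repP (g : GT) : D (rep g) = val g.
Proof. by have /eqP := xchooseP (subg_mset_surj g). Qed.

Let of_mset s : GT := Subg (mset_perm_in s).
Let of_rep (g : GT) : of_mset (rep g) = g.
Proof. by apply: val_inj; rewrite /= repP. Qed.

Let actG (x g : GT) : GT := of_mset (map (val g) (rep x)).

Let actGE s (g : GT) : actG (of_mset s) g = of_mset (map (val g) s).
Proof.
apply: val_inj => /=; apply: mset_perm_map; last by rewrite repP.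
by exists (rep g); rewrite repP.
Qed.

Let addGE s t : of_mset s * actG (of_mset t) (of_mset s) = of_mset (s ++ t).
Proof. by apply: val_inj; rewrite actGE /= mset_perm_cat. Qed.

Let actG1 (x : GT) : actG x 1 = x.
Proof.
by rewrite -(of_rep x) actGE (@eq_map _ _ _ id) ?map_id // => y; rewrite /= perm1.
Qed.

Let actGM (x g h : GT) : actG x (g * h) = actG (actG x g) h.
Proof.
rewrite -(of_rep x) !actGE -map_comp; congr of_mset.
by apply: eq_map => y; rewrite /= permM.
Qed.

Let mulGC (x y : GT) : x * actG y x = y * actG x y.
Proof.
rewrite -(of_rep x) -(of_rep y) !addGE; apply: val_inj => /=.
exact/mset_perm_perm/permEl/perm_catC.
Qed.

Let actGMr (x y g : GT) : actG (x * actG y x) g = actG x g * actG (actG y g) (actG x g).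
Proof. by rewrite -(of_rep x) -(of_rep y) addGE !(actGE _ g) addGE map_cat. Qed.

(** The addition of this brace is induced by the union of multisets
    ([addGE]). *)
Definition perm_brace : brace := Brace actG1 actGM mulGC actGMr.

Definition gen_elt x : perm_brace := of_mset [:: x].

Definition perm_act (x : X) (g : perm_brace) : X := val (g : GT) x.
Fact perm_act1 x : perm_act x 1 = x. Proof. exact: perm1. Qed.
Fact perm_actM x (g h : perm_brace) : perm_act x (g * h) = perm_act (perm_act x g) h.
Proof. exact: permM. Qed.
Definition perm_action := TotalAction perm_act1 perm_actM.

Lemma perm_act_in g : g \in Gam -> exists h : perm_brace, forall y, perm_act y h = g y.
Proof. by move=> Gg; exists (Subg Gg). Qed.

Lemma multiple_gen n x : multiple n (gen_elt x) = of_mset (nseq n x) :> GT.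
Proof.
elim: n => [|n IHn]; first by apply: val_inj.
by rewrite multipleS IHn; apply: addGE [:: x] _.
Qed.

Lemma perm_spanning_set : indecomposable S -> spanning_set perm_action [set: X] gen_elt.
Proof.
move=> trS; split.
- apply/imsetP; have [x _] := imsetP trS => orbx; exists x => //.
  apply/setP=> y; rewrite inE; apply/esym.
  have: y \in [set: X] by rewrite inE.
  rewrite orbx => /imsetP[g Gg ->]; have [h hE] := perm_act_in Gg.
  by apply/imsetP; exists h; rewrite ?inE //= hE.
- rewrite /faithful subG1; apply/trivgPn=> -[g]; rewrite inE => /andP[_ /astabP fixg].
  by case/eqP; apply/val_inj/permP=> x; rewrite perm1; apply: (fixg x); rewrite inE.
- by move=> x g _; apply: esym (actGE [:: x] g).
move=> K [K1 KD] sK g; rewrite -[g]of_rep; elim: (rep g) => [|x s IHs].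
  suff -> : of_mset [::] = 1 :> perm_brace by [].
  exact: val_inj.
rewrite -(addGE [:: x] s); apply: (KD (gen_elt x)) => //.
by apply: sK; apply/imset_f; rewrite inE.
Qed.

(** Both sides satisfy the recursion
    [E n.+1 y = d (E n x) (E n y)]. *)
Lemma Omega_multiple n x y :
  Omega S (fun i : 'I_n.+1 => if i == ord_max then y else x) = D (nseq n x) y.
Proof.
elim: n y => [|n IHn] y; first by rewrite /= perm1.
have eD : nseq n.+1 x = rcons (nseq n x) x by elim: n {IHn} => //= n ->.
have omE k (u v : 'I_k.+1 -> X) : u =1 v -> Omega S u = Omega S v.
  by move=> euv; elim: k u v euv => [|k IHk] u v euv /=; rewrite ?euv //;
     congr (dot _ _ _); apply: IHk => i; rewrite euv.
rewrite eD -cats1 mset_perm_cat permM /= mset_perm1 left_divE; congr (dot _ _ _).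
  rewrite -IHn; apply: omE => i.
  by rewrite eq_sym (negPf (neq_lift _ _)) if_same.
rewrite -IHn; apply: omE => i; congr (if _ then _ else _).
rewrite -!val_eqE /= /bump inordK // leqNgt.
by case: ltngtP (leq_ord i) => //= [lt_i|->] _; rewrite ?eqxx // ltn_eqF // ltnW.
Qed.

Lemma Dehornoy_multiple e :
  Dehornoy_condition S e <-> forall x, multiple e (gen_elt x) = 1.
Proof.
split=> [De x|mul1 x y].
  rewrite multiple_gen; apply/val_inj/permP=> y /=.
  by rewrite -Omega_multiple De perm1.
by rewrite Omega_multiple -[D _]/(val (of_mset _)) -multiple_gen mul1 perm1.
Qed.

End SolutionBrace.

Lemma square_free_dvdn n e : square_free n -> 0 < n ->
  (forall p, prime p -> p %| n -> p %| e) -> n %| e.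
Proof.
move=> sqn n_gt0 dvp; apply/dvdn_partP => // p; rewrite mem_primes => /and3P[pr_p _ p_dv].
rewrite p_part; have [le1|gt1] := leqP (logn p n) 1.
  by apply: dvdn_trans (dvp p pr_p p_dv); rewrite -[X in _ %| X]expn1 dvdn_exp2l.
have p1 : p = 1%N by apply: sqn; rewrite pfactor_dvdn.
by rewrite p1 in pr_p.
Qed.

Theorem proposition5p15 (X : finType) (S : solution X)
  (indecS : indecomposable S) (sqfX : square_free #|X|) :
  is_Dehornoy_class S #|X|.
Proof.
have bS := perm_spanning_set indecS.
have X_gt0 : 0 < #|X|.
  by have [x] := sol_nonempty S; apply/card_gt0P; exists x.
split=> //.
  apply/Dehornoy_multiple => x; rewrite -cardsT.
  by apply: (square_free_exponent bS); rewrite cardsT.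
move=> e e_gt0 /Dehornoy_multiple mul1; apply: dvdn_leq => //.
apply: square_free_dvdn => // p pr_p p_dv.
have dvG : p %| #|[set: additive (perm_brace S)]|.
  apply: dvdn_trans p_dv _; rewrite -[#|X|]cardsT cardsT.
  by have := atrans_dvd (bs_trans bS); rewrite !cardsT.
have [g _ og] := Cauchy pr_p dvG.
have all1 (h : perm_brace S) : multiple e h = 1.
  apply/eqP; apply: (bs_add_ind bS (P := fun h => multiple e h == 1)) => [|u v|x _].
  - by rewrite multiple1.
  - by move=> /eqP eu /eqP ev; rewrite multipleD eu ev badd0.
  by rewrite mul1.
by rewrite -og order_dvdn; apply/eqP/(all1 g).
Qed.
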